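(* Assume that there exist a probability measure $\alpha$ on $E$ and constants $C,\gamma>0$ such that $$\left\|\mathbb{P}_\mu(X_t\in\cdot\mid t<\tau_\partial)-\alpha\right\|_{TV}\leq C e^{-\gamma t},\qquad\forall \mu\in\mathcal{P}(E),\ \forall t\geq 0.$$ Let $\eta$ be the associated function and let $\beta(dx)=\eta(x)\alpha(dx)$ (defined in the context). Then there exists a positive constant $a_4$ such that, for all $x\in E$, all $T>0$ and all bounded measurable functions $f:E\to\mathbb{R}$, $$\left|\mathbb{E}_x\left(\frac{1}{T}\int_0^T f(X_t)\,dt\ \Big|\ T<\tau_\partial\right)-\int_E f\,d\beta\right|\leq \frac{a_4\,\|f\|_\infty}{T}.$$
   Context: Setting. $(\Omega,(\mathcal{F}_t)_{t\geq 0},(X_t)_{t\geq 0},(\mathbb{P}_x)_{x\in E\cup\{\partial\}})$ is a time-homogeneous Markov process with state space $E\cup\{\partial\}$, where $E$ is a measurable space and $\partial\notin E$. The point $\partial$ is absorbing: $X_s=\partial$ implies $X_t=\partial$ for all $t\geq s$, $\mathbb{P}_x$-almost surely for all $x\in E$. Set $\tau_\partial:=\inf\{t\geq 0: X_t=\partial\}$, which is a stopping time. It is assumed that $\mathbb{P}_x(\tau_\partial<\infty)=1$ and $\mathbb{P}_x(t<\tau_\partial)>0$ for all $t\geq 0$ and all $x\in E$. $\mathbb{E}_x$ is the expectation under $\mathbb{P}_x$. $\mathcal{P}(E)$ is the set of probability measures on $E$; for $\mu\in\mathcal{P}(E)$, $\mathbb{P}_\mu=\int_E\mathbb{P}_x\,\mu(dx)$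 is the law of the process with initial distribution $\mu$. $\|\cdot\|_{TV}$ is the total variation norm and $\|f\|_\infty=\sup_{x\in E}|f(x)|$. As is implicit in writing the time integral, $(t,\omega)\mapsto X_t(\omega)$ is jointly measurable. Objects associated with the assumption. Under the assumption of the claim (uniform exponential convergence to $\alpha$), the following facts are known from earlier work. The measure $\alpha$ is the unique quasi-stationary distribution of $X$, i.e. the unique probability measure on $E$ with $\mathbb{P}_\alpha(X_t\in\cdot\mid t<\tau_\partial)=\alpha$ for all $t\ge0$. There is a constant $\lambda_0>0$ such that $\mathbb{P}_\alpha(t<\tau_\partial)=e^{-\lambda_0 t}$ for all $t\ge 0$, and there is a function $\eta:E\to(0,\infty)$ with $\int_E\eta\,d\alpha=1$ such that $$\lim_{t\to+\infty}\sup_{x\in E}\left|e^{\lambda_0 t}\mathbb{P}_x(t<\tau_\partial)-\eta(x)\right|=0.$$ The probability measure $\beta$ on $E$ is defined by $\beta(dx)=\eta(x)\alpha(dx)$. The $Q$-process is the family $(\mathbb{Q}_x)_{x\in E}$ of probability measures on $\Omega$ defined by $\mathbb{Q}_x(\Gamma)=\lim_{t\to+\infty}\mathbb{P}_x(\Gamma\mid t<\tau_\partial)$ for all $\Gamma\in\mathcal{F}_s$, $s\geq 0$; it is well defined, $X$ is an $E$-valued homogeneous Markov process under it with unique invariant probability measure $\beta$, and there exist constants $C',\gamma'>0$ such that $\|\mathbb{Q}_x(X_t\in\cdot)-\beta\|_{TV}\leq C'e^{-\gamma' t}$ for all $x\in E$ and $t\geq 0$. *)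

(* Defs.v *)
From HB Require Import structures.
From mathcomp Require Import all_boot all_order all_algebra.
From mathcomp Require Import all_classical all_reals all_analysis.

Set Implicit Arguments.
Unset Strict Implicit.
Unset Printing Implicit Defensive.

Import Order.TTheory GRing.Theory Num.Theory.
Import numFieldNormedType.Exports.

Local Open Scope classical_set_scope.
Local Open Scope ring_scope.

(** The state space [E] with a cemetery point adjoined is [option E], the
    cemetery being [None].  Its sigma-algebra is generated by the measurable
    subsets of [E] and [{None}]: [B] is measurable iff its trace on [E] is. *)
Section option_measurable.
Context d (E : measurableType d).

Definition option_measurable : set (set (option E)) :=
  [set B | measurable (Some @^-1` B)].

Lemma option_measurable0 : option_measurable set0.
Proof. by rewrite /option_measurable /= preimage_set0. Qed.

Lemma option_measurableC B : option_measurable B -> option_measurable (~` B).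
Proof. by rewrite /option_measurable /= preimage_setC; exact: measurableC. Qed.

Lemma option_measurable_bigcup (F : (set (option E))^nat) :
  (forall i, option_measurable (F i)) -> option_measurable (\bigcup_i F i).
Proof.
move=> mF; rewrite /option_measurable /= preimage_bigcup.
by apply: bigcupT_measurable => i; exact: mF.
Qed.

HB.instance Definition _ := isPointed.Build (option E) None.
HB.instance Definition _ := @isMeasurable.Build d (option E)
  option_measurable option_measurable0 option_measurableC
  option_measurable_bigcup.

End option_measurable.

Section absorbed_process.
Context {R : realType} {dO dE : measure_display}
  {Omega : measurableType dO} {E : measurableType dE}.

(** [tau w = +oo] when the cemetery is never reached. *)
Definition absorption_time (X : R -> Omega -> option E) (w : Omega) : \bar R :=
  ereal_inf [set t%:E | t in [set t | 0 <= t /\ X t w = None]].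

Definition alive (X : R -> Omega -> option E) (t : R) : set Omega :=
  [set w | (t%:E < absorption_time X w)%E].

(** Times are the nonnegative reals: the values of [F] and [X] at negative
    arguments are irrelevant.  [F] is the filtration and [P x] the law of the
    process started from [x]. *)
Record absorbed_markov_process (F : R -> set (set Omega))
    (X : R -> Omega -> option E) (P : R.-pker (option E) ~> Omega) : Prop := {
  filtration_sigma_algebra : forall t, 0 <= t -> sigma_algebra setT (F t) ;
  filtration_measurable : forall t, 0 <= t -> F t `<=` measurable ;
  filtration_nondecreasing : forall s t, 0 <= s -> s <= t -> F s `<=` F t ;
  process_adapted : forall t, 0 <= t ->
    forall B : set (option E), measurable B -> F t (X t @^-1` B) ;
  process_jointly_measurable :
    measurable_fun [set z : R * Omega | 0 <= z.1] (fun z => X z.1 z.2) ;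
  (* stated on laws because singletons of [E] need not be measurable *)
  process_start : forall (x : option E) (B : set (option E)), measurable B ->
    P x (X 0 @^-1` B) = (\d_x B : \bar R) ;
  (* P_x (X_(s+t) \in B | F_s) = P_(X_s) (X_t \in B) *)
  process_markov : forall (x : option E) (s t : R), 0 <= s -> 0 <= t ->
    forall (G : set Omega) (B : set (option E)), F s G -> measurable B ->
    P x (G `&` X (s + t) @^-1` B) =
      (\int[P x]_(w in G) P (X s w) (X t @^-1` B))%E ;
  cemetery_absorbing : forall x : E, {ae P (Some x), forall w,
    forall s t, 0 <= s -> s <= t -> X s w = None -> X t w = None} ;
  absorption_stopping_time : forall t, 0 <= t ->
    F t [set w | (absorption_time X w <= t%:E)%E] ;
  absorption_finite : forall x : E,
    P (Some x) [set w | (absorption_time X w < +oo)%E] = 1%E ;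
  alive_gt0 : forall (x : E) t, 0 <= t -> (0 < P (Some x) (alive X t))%E
}.

Definition Pinit (P : R.-pker (option E) ~> Omega) (mu : probability E R)
    (G : set Omega) : \bar R :=
  (\int[mu]_x P (Some x) G)%E.

(** [cond_law P X mu t A] is P_mu (X_t \in A | t < tau). *)
Definition cond_law (P : R.-pker (option E) ~> Omega)
    (X : R -> Omega -> option E) (mu : probability E R) (t : R) (A : set E) : R :=
  fine (Pinit P mu (X t @^-1` (Some @` A) `&` alive X t)) /
  fine (Pinit P mu (alive X t)).

(** Expectation under [Q] conditionally on an event [G] of positive
    probability. *)
Definition cond_expectation (Q : {measure set Omega -> \bar R})
    (G : set Omega) (Y : Omega -> R) : R :=
  (\int[Q]_(w in G) Y w)%R / fine (Q G).

(** (1/T) * int_0^T f(X_t) dt, with [f] extended by 0 at the cemetery; on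
    the event T < tau this extension plays no role. *)
Definition time_average (X : R -> Omega -> option E) (f : E -> R) (T : R)
    (w : Omega) : R :=
  T^-1 * (\int[lebesgue_measure]_(t in `[0%R, T]) oapp f 0 (X t w))%R.

(** |nu|(E) for a finite signed measure [nu]: the supremum of the sums of
    |nu (A_i)| over finite measurable partitions (A_i) of [E].  For a
    difference of probability measures, this is twice the supremum of
    |nu A| over measurable [A]. *)
Definition tv_norm (nu : set E -> R) : \bar R :=
  ereal_sup [set v | exists n (A : 'I_n -> set E),
    [/\ forall i, measurable (A i), trivIset setT A, \bigcup_i A i = setT
      & v = (\sum_(i < n) `|nu (A i)|)%:E]].

Definition sup_norm (f : E -> R) : R := sup (range (fun x => `|f x|)).

(** The pair ([lambda0], [eta]) associated with [alpha]; both are determined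
    by [alpha] and the process. *)
Record survival_rate_and_profile (P : R.-pker (option E) ~> Omega)
    (X : R -> Omega -> option E) (alpha : probability E R)
    (lambda0 : R) (eta : E -> R) : Prop := {
  rate_gt0 : 0 < lambda0 ;
  rate_survival : forall t, 0 <= t ->
    Pinit P alpha (alive X t) = (expR (- (lambda0 * t)))%:E ;
  profile_gt0 : forall x, 0 < eta x ;
  profile_normalized : (\int[alpha]_x (eta x)%:E)%E = 1%E ;
  profile_limit :
    ereal_sup (range (fun x : E =>
      `| (expR (lambda0 * t))%:E * P (Some x) (alive X t) - (eta x)%:E |%E))
    @[t --> +oo%R] --> 0%E
}.

End absorbed_process.

(* Main.v *)
Require Import Defs.
From HB Require Import structures.
From mathcomp Require Import all_boot all_order all_algebra.
From mathcomp Require Import all_classical all_reals all_analysis.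
From mathcomp Require Import measurable_realfun ring lra.

Set Implicit Arguments.
Unset Strict Implicit.
Unset Printing Implicit Defensive.

Import Order.TTheory GRing.Theory Num.Theory.
Import numFieldNormedType.Exports.
Local Open Scope classical_set_scope.
Local Open Scope ring_scope.

(** Write S_t(x) = P_x(t < tau), and E_x[f(X_t); s < tau] for the integral of
    f(X_t) over the event s < tau under P_x.  Two facts drive the proof.

    The first is the Markov property in the form
    E_x[f(X_t); t + u < tau] = E_x[(f S_u)(X_t); t < tau]
    ([markov_mean_alive]).  It turns conditioning on a late survival into the
    weight S_u at time t, so that the conditional mean of f(X_t) given
    t + u < tau is the ratio of the means of f S_u and of S_u under the
    conditional law of X_t given t < tau.

    The second is the hypothesis itself: that conditional law is within
    C exp(- gamma t) of alpha, whence a mean of h under it is close to the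
    integral of h against alpha, up to a multiple of the bound of h
    ([mean_alive_tv_gap]).

    Let g_u = exp(lambda0 u) S_u.  It integrates to 1 against alpha and tends
    uniformly to eta, so it is bounded by a constant K independent of u
    ([rescaled_survival_bounded]).  Applied with f = 1, the two facts say that
    g_{t+u} - g_t is of order exp(- gamma t) uniformly in u; letting u tend to
    infinity upgrades the convergence of g_t to eta to an exponential rate
    ([rescaled_survival_rate]).  Applied to a general f, they replace the
    numerator f g_u by the integral of f eta against alpha, which is the
    integral of f against beta, and the denominator by 1, with errors of order
    exp(- gamma t) + exp(- gamma u) ([conditional_mean_rate]).

    Finally the conditional expectation of the time average over [0, T] is, by
    Fubini, the average over t in [0, T] of the conditional means with
    u = T - t, and the integral of exp(- gamma t) + exp(- gamma (T - t)) over
    [0, T] is at most 2 / gamma, independently of T.  Dividing by T gives the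
    claim. *)

(** * Comparing integration functionals through measurable sets *)

Section positive_functionals.
Context {d : measure_display} {S : measurableType d} {R : realType}.
Implicit Types (f g : S -> R) (I J : (S -> R) -> R).

Definition bounded_measurable f :=
  measurable_fun setT f /\ exists M, forall y, `|f y| <= M.

(** What the integrals below have in common: it lets one compare integrals over
    different spaces (the law of the process, alpha, beta) as functionals of
    the same test function. *)
Record positive_linear I : Prop := {
  positive_linear_lin : forall a f g,
    bounded_measurable f -> bounded_measurable g ->
    I (fun y => a * f y + g y) = a * I f + I g ;
  positive_linear_mono : forall f g,
    bounded_measurable f -> bounded_measurable g ->
    (forall y, f y <= g y) -> I f <= I g }.

Lemma bounded_measurable_cst c : bounded_measurable (fun=> c).
Proof. by split; [exact: measurable_cst|exists `|c|]. Qed.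

Lemma bounded_measurable_indic B : measurable B -> bounded_measurable (\1_B).
Proof.
move=> mB; split; first exact/measurable_indicP.
by exists 1 => y; rewrite indicE; case: (_ \in _); rewrite ?normr1 ?normr0.
Qed.

Lemma bounded_measurableM f g : bounded_measurable f -> bounded_measurable g ->
  bounded_measurable (fun y => f y * g y).
Proof.
move=> [mf [M fM]] [mg [N gN]]; split; first exact: measurable_funM.
by exists (M * N) => y; rewrite normrM ler_pM.
Qed.

Lemma bounded_measurable_lin a f g :
  bounded_measurable f -> bounded_measurable g ->
  bounded_measurable (fun y => a * f y + g y).
Proof.
move=> [mf [M fM]] [mg [N gN]]; split.
  by apply: measurable_funD => //; apply: measurable_funM => //; exact: measurable_cst.
exists (`|a| * M + N) => y.
by rewrite (le_trans (ler_normD _ _))// lerD// normrM ler_wpM2l.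
Qed.

Lemma positive_linear_cst I c : positive_linear I -> I (fun=> c) = c * I (fun=> 1).
Proof.
move=> pI; have b1 := bounded_measurable_cst 1.
have b0 := bounded_measurable_cst 0.
have I0 : I (fun=> 0) = 0.
  have E : (fun=> 0) = (fun y : S => 1 * 0 + 0) :> (S -> R).
    by apply/funext => y; rewrite mul1r addr0.
  have := positive_linear_lin pI 1 b0 b0; rewrite -E mul1r => /eqP.
  by rewrite -subr_eq0 opprD addrA subrr sub0r oppr_eq0 => /eqP.
have E : (fun=> c) = (fun y : S => c * 1 + 0).
  by apply/funext => y; rewrite mulr1 addr0.
by rewrite E positive_linear_lin// I0 addr0.
Qed.

Lemma positive_linear_dist I f g c : positive_linear I ->
  bounded_measurable f -> bounded_measurable g ->
  (forall y, `|f y - g y| <= c) -> `|I f - I g| <= c * I (fun=> 1).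
Proof.
move=> pI bf bg fgc; have b1 := bounded_measurable_cst 1.
have bc := bounded_measurable_cst c.
have le_shift h k : bounded_measurable h -> bounded_measurable k ->
    (forall y, h y <= c + k y) -> I h - I k <= c * I (fun=> 1).
  move=> bh bk hk; rewrite lerBlDr -(positive_linear_lin pI)//.
  apply: (positive_linear_mono pI) => // [|y]; first exact: bounded_measurable_lin.
  by rewrite mulr1.
rewrite ler_norml lerNl opprB !le_shift// => y;
  by have := fgc y; rewrite ler_norml => /andP[]; lra.
Qed.

(** For f with values in [0, 1], this is f rounded down to a multiple of 1/n,
    written through superlevel sets so that a functional sees only
    indicators. *)
Definition staircase (n : nat) f (y : S) : R :=
  \sum_(k < n) n%:R^-1 * \1_[set z | (k.+1)%:R / n%:R <= f z] y.

Lemma measurable_superlevel f c : measurable_fun setT f ->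
  measurable [set z | c <= f z].
Proof.
move=> mf; rewrite [X in measurable X](_ : _ = f @^-1` `[c, +oo[).
  by rewrite -[X in measurable X]setTI; exact: mf.
by apply/seteqP; split => z /=; rewrite in_itv/= andbT.
Qed.

Lemma staircase_close n f y : (0 < n)%N -> 0 <= f y <= 1 ->
  `|f y - staircase n f y| <= n%:R^-1.
Proof.
move=> n0 /andP[f0 f1]; have n0' : 0 < n%:R :> R by rewrite ltr0n.
have nf0 : 0 <= n%:R * f y by rewrite mulr_ge0// ltW.
set j := Num.truncn (n%:R * f y).
have [jle ltj] : j%:R <= n%:R * f y /\ n%:R * f y < j.+1%:R.
  by have /andP[] := truncn_itv nf0.
have jn : (j <= n)%N.
  by rewrite -(ler_nat R) (le_trans jle)// -[leRHS]mulr1 ler_wpM2l// ltW.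
(* Exactly the j superlevel sets with k.+1 <= n f(y) contain y. *)
have -> : staircase n f y = j%:R / n%:R.
  rewrite /staircase -mulr_sumr mulrC; congr (_ / _).
  rewrite (eq_bigr (fun k : 'I_n => (k < j)%N%:R)); last first.
    move=> k _; rewrite indicE; congr (_%:R); congr nat_of_bool.
    apply/idP/idP.
      rewrite inE/= ler_pdivrMr// mulrC => /le_lt_trans/(_ ltj).
      by rewrite ltr_nat.
    move=> kj; rewrite inE/= ler_pdivrMr// mulrC (le_trans _ jle)//.
    by rewrite ler_nat.
  rewrite -natr_sum; congr (_%:R).
  rewrite -(big_mkord xpredT (fun k => nat_of_bool (k < j)%N)).
  rewrite (big_cat_nat (leq0n j) jn)//=.
  have -> : (\sum_(j <= k < n) (k < j)%N = 0)%N.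
    rewrite big_nat_cond big1// => k /andP[/andP[jk _] _].
    by rewrite ltnNge jk.
  rewrite addn0 big_nat_cond (eq_bigr (fun=> 1%N)).
    by rewrite -big_nat_cond sum_nat_const_nat subn0 muln1.
  by move=> k /andP[/andP[_ ->]].
rewrite -(ler_pM2l n0') -[X in X * `|_|]gtr0_norm// -normrM mulrBr mulfV ?gt_eqF//.
rewrite mulrCA mulfV ?gt_eqF// mulr1 ger0_norm ?subr_ge0//.
by rewrite lerBlDl natr1 ltW.
Qed.

Lemma bounded_measurable_partial_staircase m n f : measurable_fun setT f ->
  bounded_measurable (fun y : S =>
    \sum_(k < m) n%:R^-1 * \1_[set z | (k.+1)%:R / n%:R <= f z] y).
Proof.
move=> mf; elim: m => [|m IH].
  rewrite [X in bounded_measurable X](_ : _ = fun=> 0).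
    exact: bounded_measurable_cst.
  by apply/funext => y; rewrite big_ord0.
under eq_fun do rewrite big_ord_recr/= addrC.
apply: bounded_measurable_lin => //; apply: bounded_measurable_indic.
exact: measurable_superlevel.
Qed.

Lemma bounded_measurable_staircase n f : measurable_fun setT f ->
  bounded_measurable (staircase n f).
Proof. exact: bounded_measurable_partial_staircase. Qed.

(** The n superlevel sets of the staircase each contribute at most e / n to the
    difference; the rounding error vanishes as n grows. *)
Lemma positive_linear_gap01 I J e f : positive_linear I -> positive_linear J ->
  (forall B, measurable B -> `|I (\1_B) - J (\1_B)| <= e) ->
  measurable_fun setT f -> (forall y, 0 <= f y <= 1) -> `|I f - J f| <= e.
Proof.
move=> pI pJ IJ mf f01.
have bf : bounded_measurable f.
  by split=> //; exists 1 => y; have /andP[f0 f1] := f01 y; rewrite ger0_norm.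
have bs n := bounded_measurable_staircase n mf.
have gap_stair n : (0 < n)%N -> `|I (staircase n f) - J (staircase n f)| <= e.
  move=> n0.
  have stair K m : positive_linear K ->
      K (fun y => \sum_(k < m)
           n%:R^-1 * \1_[set z | (k.+1)%:R / n%:R <= f z] y) =
      \sum_(k < m) n%:R^-1 * K (\1_[set z | (k.+1)%:R / n%:R <= f z]).
    move=> pK; elim: m => [|m IH].
      rewrite big_ord0 -[RHS](mul0r (K (fun=> 1))) -(positive_linear_cst _ pK).
      by congr K; apply/funext => y; rewrite big_ord0.
    rewrite big_ord_recr/= -IH addrC -(positive_linear_lin pK).
    - by congr K; apply/funext => y; rewrite big_ord_recr/= addrC.
    - by apply: bounded_measurable_indic; exact: measurable_superlevel.
    - exact: bounded_measurable_partial_staircase.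
  rewrite /staircase !stair// -sumrB (le_trans (ler_norm_sum _ _ _))//.
  rewrite (@le_trans _ _ (\sum_(k < n) n%:R^-1 * e))//.
    apply: ler_sum => k _; rewrite -mulrBr normrM ger0_norm ?invr_ge0//.
    by rewrite ler_wpM2l ?invr_ge0//; apply: IJ; exact: measurable_superlevel.
  rewrite sumr_const card_ord -(mulr_natl (_ * _)) mulrA mulfV ?mul1r// pnatr_eq0.
  by rewrite -lt0n.
pose c := I (fun=> 1) + J (fun=> 1).
have close n : (0 < n)%N -> `|I f - J f| <= e + n%:R^-1 * c.
  move=> n0.
  have := positive_linear_dist pI bf (bs n) (fun y => staircase_close n0 (f01 y)).
  have := positive_linear_dist pJ bf (bs n) (fun y => staircase_close n0 (f01 y)).
  have := gap_stair n n0; rewrite /c mulrDr.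
  set a := I f; set b := J f; set a' := I _; set b' := J _ => h1 h2 h3.
  rewrite (_ : a - b = (a' - b') + (a - a') - (b - b')); last by ring.
  by rewrite (le_trans (ler_normB _ _))// (le_trans (lerD (ler_normD _ _) (lexx _)))//; lra.
rewrite leNgt; apply/negP => lt_e.
have c0 : 0 <= c.
  have b1 := bounded_measurable_cst 1; have b0 := bounded_measurable_cst 0.
  have pos K : positive_linear K -> 0 <= K (fun=> 1).
    move=> pK; rewrite -[leLHS](mul0r (K (fun=> 1))) -(positive_linear_cst _ pK).
    by apply: (positive_linear_mono pK) => // y.
  by rewrite addr_ge0 ?pos.
have d0 : 0 < `|I f - J f| - e by rewrite subr_gt0.
(* Any n > c / (|I f - J f| - e) contradicts [close]. *)
pose n := (Num.truncn (c / (`|I f - J f| - e))).+1.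
have := close n isT; rewrite leNgt => /negP; apply.
rewrite -ltrBrDl mulrC ltr_pdivrMr ?ltr0n// mulrC -ltr_pdivrMr//.
by rewrite /n real_truncnS_gt ?num_real.
Qed.

(** Control on sets implies control on bounded functions.  Rescaling f to
    (f + M) / (2 M), with values in [0, 1], costs the factor 2 M, and the
    constant that is then subtracted costs one more M. *)
Lemma positive_linear_gap I J e M f : positive_linear I -> positive_linear J ->
  (forall B, measurable B -> `|I (\1_B) - J (\1_B)| <= e) ->
  measurable_fun setT f -> (forall y, `|f y| <= M) -> `|I f - J f| <= 3 * M * e.
Proof.
move=> pI pJ IJ mf fM.
have [M0|M0] := leP M 0.
  have f0 : f = fun=> 0.
    by apply/funext => y; apply/eqP; rewrite -normr_le0 (le_trans (fM y)).
  have -> : I f - J f = 0 by rewrite f0 !(positive_linear_cst 0)// !mul0r subrr.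
  have [M0'|Mn] := eqVneq M 0; first by rewrite M0' mulr0 mul0r normr0.
  have := fM point; rewrite f0 normr0 => M0'.
  by rewrite (_ : M = 0) ?mulr0 ?mul0r ?normr0//; apply/eqP; rewrite eq_le M0 M0'.
pose g y := (2 * M)^-1 * f y + 2^-1.
have M2 : 0 < 2 * M by rewrite mulr_gt0.
have bf : bounded_measurable f by split=> //; exists M.
have bc := bounded_measurable_cst (2^-1).
have mg : measurable_fun setT g by have [] := bounded_measurable_lin (2 * M)^-1 bf bc.
have g01 y : 0 <= g y <= 1.
  have := fM y; rewrite ler_norml => /andP[f1 f2].
  have gE : 2 * M * g y = f y + M by rewrite /g; field; rewrite gt_eqF.
  by rewrite -(pmulr_rge0 _ M2) -[g y <= 1](ler_pM2l M2) gE; apply/andP; split; lra.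
have h1 := positive_linear_gap01 pI pJ IJ mg g01.
have h2 : `|I (fun=> 1) - J (fun=> 1)| <= e.
  rewrite (_ : (fun=> 1) = \1_setT :> (S -> R)); first exact: IJ.
  by apply/funext => y; rewrite indicE in_setT.
have gE K : positive_linear K -> K f = 2 * M * K g - M * K (fun=> 1).
  move=> pK; rewrite /g (positive_linear_lin pK)// (positive_linear_cst _ pK); field.
  by rewrite gt_eqF.
rewrite !gE// [X in `|X|](_ : _ =
  2 * M * (I g - J g) - M * (I (fun=> 1) - J (fun=> 1))); last by ring.
rewrite (le_trans (ler_normB _ _))// !normrM (gtr0_norm M0) ger0_norm//.
rewrite (_ : 3 * M * e = 2 * M * e + M * e); last by ring.
by rewrite lerD// ler_wpM2l// ltW.
Qed.

Lemma positive_linear_eq I J f : positive_linear I -> positive_linear J ->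
  (forall B, measurable B -> I (\1_B) = J (\1_B)) ->
  bounded_measurable f -> I f = J f.
Proof.
move=> pI pJ IJ [mf [M fM]]; apply/eqP; rewrite -subr_eq0 -normr_le0.
apply: (@le_trans _ _ (3 * M * 0)); last by rewrite mulr0.
by apply: (positive_linear_gap pI pJ _ mf fM) => B mB; rewrite IJ// subrr normr0.
Qed.

Lemma positive_linearZ c I : 0 <= c -> positive_linear I ->
  positive_linear (fun f => c * I f).
Proof.
move=> c0 pI; split=> [a f g bf bg|f g bf bg fg].
  by rewrite positive_linear_lin// mulrDr mulrCA.
by rewrite ler_wpM2l// positive_linear_mono.
Qed.

End positive_functionals.

(** * Weighted integrals as positive functionals *)

Section weighted_integrals.
Context {dT d : measure_display} {T : measurableType dT} {S : measurableType d}
  {R : realType}.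
Variables (m : {measure set T -> \bar R}) (D : set T) (phi : T -> S).
Hypotheses (mD : measurable D) (mphi : measurable_fun setT phi).

Section weight.
Variable g : T -> R.
Hypotheses (ig : m.-integrable D (EFin \o g)) (g0 : forall w, D w -> 0 <= g w).

Lemma integrable_weighted f : bounded_measurable f ->
  m.-integrable D (EFin \o (fun w => f (phi w) * g w)).
Proof.
move=> [mf [M fM]].
have := @integrableMr _ _ _ m D mD (f \o phi) (EFin \o g).
apply => //; first by apply: measurable_funTS; exact: measurableT_comp.
exists M; split; first exact: num_real.
by move=> x Mx w _; rewrite /= (le_trans (fM _))// ltW.
Qed.

Lemma positive_linear_integral :
  positive_linear (fun f : S -> R => \int[m]_(w in D) (f (phi w) * g w)).
Proof.
split=> [a f h bf bh|f h bf bh fh].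
  rewrite -RintegralZl//; last exact: integrable_weighted.
  rewrite -RintegralD//.
  - by apply: eq_Rintegral => w _; rewrite mulrDl mulrA.
  - under [X in integrable _ _ X]eq_fun do rewrite /= mulrA.
    apply: (@integrable_weighted (fun y => a * f y)).
    apply: bounded_measurableM => //; exact: bounded_measurable_cst.
  - exact: integrable_weighted.
apply: le_Rintegral => //; [exact: integrable_weighted..|].
by move=> w Dw; rewrite ler_wpM2r// g0.
Qed.

End weight.

Hypothesis mDoo : (m D < +oo)%E.

Let integrable1 : m.-integrable D (EFin \o (fun=> 1)).
Proof.
apply: measurable_bounded_integrable => //.
exact: bounded_cst.
Qed.

Lemma integrable_mean f : bounded_measurable f ->
  m.-integrable D (EFin \o (f \o phi)).
Proof.
move=> /(integrable_weighted integrable1); apply: eq_integrable => // w _.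
by rewrite /= mulr1.
Qed.

Lemma positive_linear_mean :
  positive_linear (fun f : S -> R => \int[m]_(w in D) f (phi w)).
Proof.
have /(_ integrable1) := @positive_linear_integral (fun=> 1).
move=> /(_ (fun _ _ => ler01)).
by under [X in positive_linear X]eq_fun do under eq_Rintegral do rewrite mulr1.
Qed.

End weighted_integrals.

Section indicators.
Context {dT d : measure_display} {T : measurableType dT} {S : measurableType d}
  {R : realType}.
Variables (m : {measure set T -> \bar R}) (D : set T) (phi : T -> S).
Hypotheses (mD : measurable D) (mphi : measurable_fun setT phi).

Let mpreimage B : measurable B -> measurable (phi @^-1` B).
Proof. by move=> mB; rewrite -[X in measurable X]setTI; exact: mphi. Qed.

Lemma Rintegral_indic_comp (g : T -> R) B : measurable B ->
  \int[m]_(w in D) (\1_B (phi w) * g w) =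
  \int[m]_(w in D `&` phi @^-1` B) g w.
Proof.
move=> mB; rewrite Rintegral_mkcondr; apply: eq_Rintegral => w _.
rewrite patchE indicE (_ : (w \in phi @^-1` B) = (phi w \in B)).
  by case: ifP => _; rewrite ?mul1r ?mul0r.
by apply/idP/idP; rewrite !inE.
Qed.

Lemma Rintegral_indic B : measurable B ->
  \int[m]_(w in D) \1_B (phi w) = fine (m (D `&` phi @^-1` B)).
Proof.
move=> mB; have := Rintegral_indic_comp (fun=> 1) mB.
under eq_Rintegral do rewrite mulr1.
move=> ->; rewrite Rintegral_cst ?mul1r//.
by apply: measurableI => //; exact: mpreimage.
Qed.

End indicators.

(** * Survival events and the Markov property *)

Lemma measure_cvg_eventually {d : measure_display} {T : measurableType d}
    {R : realType} (m : {measure set T -> \bar R}) (A_ : (set T)^nat)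
    (A : set T) :
  (m setT < +oo)%E -> (forall n, measurable (A_ n)) -> measurable A ->
  {ae m, forall w, \forall n \near \oo, A_ n w <-> A w} ->
  m (A_ n) @[n --> \oo] --> m A.
Proof.
move=> moo mA_ mA AA.
have i1 : m.-integrable setT (cst 1%E).
  apply/integrableP; split; first exact: measurable_cst.
  by under eq_integral do rewrite abse1; rewrite integral_cst// mul1e.
have [|||||_ _] := @dominated_convergence _ T R m setT measurableT
  (fun n w => (\1_(A_ n) w)%:E) (fun w => (\1_A w)%:E) (cst 1%E) => //.
- by move=> n; apply/measurable_EFinP/measurable_indicP.
- by apply/measurable_EFinP/measurable_indicP.
- apply: filterS AA => w [N _ NA] _; apply: cvg_near_cst.
  exists N => // n Nn; have [h1 h2] := NA n Nn.
  by congr (_%:E); rewrite !indicE; congr (_%:R); congr nat_of_bool;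
    apply/idP/idP; rewrite !inE.
- by apply: aeW => w n _ /=; rewrite indicE; case: (_ \in _); rewrite ?normr1 ?normr0 lee_fin.
rewrite integral_indic// setIT.
by under eq_fun do rewrite integral_indic// setIT.
Qed.

Section absorbed.
Context {R : realType} {dO dE : measure_display}
  {Omega : measurableType dO} {E : measurableType dE}
  {F : R -> set (set Omega)} {X : R -> Omega -> option E}
  {P : R.-pker (option E) ~> Omega}.
Hypothesis hX : absorbed_markov_process F X P.
Implicit Types (s t u : R) (w : Omega) (x : E) (B : set (option E)).

Lemma measurable_Some : measurable_fun setT (Some : E -> option E).
Proof. by move=> _ B mB; rewrite setTI. Qed.

Lemma measurable_process t : 0 <= t -> measurable_fun setT (X t).
Proof.
move=> t0 _ B mB; rewrite setTI.
exact: (filtration_measurable hX t0 (process_adapted hX t0 mB)).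
Qed.

Lemma alive_adapted t : 0 <= t -> F t (alive X t).
Proof.
move=> t0; have [_ FC _] := filtration_sigma_algebra hX t0.
have -> : alive X t = setT `\` [set w | (absorption_time X w <= t%:E)%E].
  rewrite setTD; apply/seteqP; split => w /=; first by rewrite leNgt => ->.
  by move=> /negP; rewrite -ltNge.
exact/FC/(absorption_stopping_time hX).
Qed.

Lemma measurable_alive t : 0 <= t -> measurable (alive X t).
Proof.
by move=> t0; exact: (filtration_measurable hX t0 (alive_adapted t0)).
Qed.

Lemma alive_preimage_adapted t B : 0 <= t -> measurable B ->
  F t (alive X t `&` X t @^-1` B).
Proof.
move=> t0 mB; have [F0 FC FU] := filtration_sigma_algebra hX t0.
rewrite -[X in F t X]setCK setCI -setTD; apply: (FC).
rewrite -bigcup2E; apply: (FU) => -[|[|n]]//=; rewrite -setTD; apply: (FC).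
  exact: alive_adapted.
exact: (process_adapted hX).
Qed.

Lemma alive_neq_None t w : 0 <= t -> alive X t w -> X t w <> None.
Proof.
move=> t0 tw Xtw; move: tw; rewrite /alive/= ltNge => /negP; apply.
by apply: ereal_inf_lbound; exists t.
Qed.

Lemma alive_nonincreasing s t : s <= t -> alive X t `<=` alive X s.
Proof. by move=> st w; rewrite /alive/=; apply: le_lt_trans; rewrite lee_fin. Qed.

Lemma kernel_lty y : (P y setT < +oo)%E.
Proof. by rewrite prob_kernel ltry. Qed.

Lemma kernel_subset_lty y (G : set Omega) : measurable G -> (P y G < +oo)%E.
Proof.
by move=> mG; rewrite (le_lt_trans _ (kernel_lty y))// le_measure ?inE.
Qed.

Lemma measurable_kernel_event (G : set Omega) : measurable G ->
  measurable_fun setT (fun y => P y G).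
Proof. by move=> mG; exact: measurable_kernel. Qed.

(** The times at which survival beyond u is tested, see [alive_eventually]. *)
Definition later u n : R := u + n.+1%:R^-1.

Lemma later_gt u n : u < later u n.
Proof. by rewrite ltrDl invr_gt0. Qed.

(** The paths need not be right-continuous, so at time u itself the process may
    still be in E although tau = u.  Looking slightly later removes the
    ambiguity: u < tau forces X to be in E at all times close enough to u, and
    by absorption tau <= u forces X to be at the cemetery at every later
    time. *)
Lemma alive_eventually x u : 0 <= u ->
  {ae P (Some x), forall w, \forall n \near \oo,
    (X (later u n) @^-1` (~` [set None])) w <-> alive X u w}.
Proof.
move=> u0; apply: filterS (cemetery_absorbing hX x) => w absw.
have [uw|nuw] := pselect (alive X u w).
  have : \forall n \near \oo, ((later u n)%:E < absorption_time X w)%E.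
    move: uw; rewrite /alive/=; case: (absorption_time X w) => [r| |]//.
      rewrite lte_fin => ur; have ru : 0 < r - u by rewrite subr_gt0.
      have := near_infty_natSinv_lt (PosNum ru); apply: filterS => n /= h.
      by rewrite lte_fin /later -ltrBrDl.
    by move=> _; apply: nearW => n; rewrite ltry.
  apply: filterS => n Ln; split=> // _ /=.
  by apply: alive_neq_None => //; rewrite (le_trans u0)// ltW// later_gt.
apply: nearW => n; split=> [/= Xn|//]; exfalso; apply: Xn.
move: nuw; rewrite /alive/= => /negP; rewrite -leNgt => tw.
have /ereal_inf_lt[_ [s [s0 Xs] <-] sn] : (absorption_time X w < (later u n)%:E)%E.
  by rewrite (le_lt_trans tw)// lte_fin later_gt.
by apply: (absw s) => //; move: sn; rewrite lte_fin => /ltW.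
Qed.

Lemma measurable_unabsorbed u : 0 <= u ->
  measurable (X u @^-1` (~` [set None])).
Proof.
move=> u0; rewrite -[X in measurable X]setTI; apply: measurable_process => //.
rewrite /measurable/= /option_measurable/= (_ : _ @^-1` _ = setT)//.
by apply/seteqP; split.
Qed.

(** The Markov property concerns X at one fixed time, whereas survival depends
    on the whole path.  It is applied to the events that X is in E at the times
    of [later], and both sides are passed to the limit by dominated
    convergence.  Since G lies in the survival event at time t,
    the integral only involves starting points in E, from which the cemetery
    is almost surely absorbing. *)
Lemma markov_alive x t u (G : set Omega) : 0 <= t -> 0 <= u -> F t G ->
    G `<=` alive X t ->
  (P (Some x) (G `&` alive X (t + u)) =
   \int[P (Some x)]_(w in G) P (X t w) (alive X u))%E.
Proof.
move=> t0 u0 FG Galive; have tu0 : 0 <= t + u by rewrite addr_ge0.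
have mG : measurable G by exact: (filtration_measurable hX t0).
have later0 v n : 0 <= v -> 0 <= later v n.
  by move=> v0; rewrite (le_trans v0)// ltW// later_gt.
have mA v n : 0 <= v -> measurable (X (later v n) @^-1` (~` [set None])).
  by move=> v0; apply: measurable_unabsorbed; exact: later0.
have malive v : 0 <= v -> measurable (alive X v) by exact: measurable_alive.
have lim_left : P (Some x) (G `&` X (later (t + u) n) @^-1` (~` [set None]))
    @[n --> \oo] --> P (Some x) (G `&` alive X (t + u)).
  apply: measure_cvg_eventually.
  - exact: kernel_lty.
  - by move=> n; apply: measurableI => //; exact: mA.
  - by apply: measurableI => //; exact: malive.
  apply: filterS (alive_eventually x tu0) => w; apply: filterS => n h.
  by split=> -[Gw] /h.
have lim_right : (\int[P (Some x)]_(w in G)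
    P (X t w) (X (later u n) @^-1` (~` [set None])))%E @[n --> \oo] -->
    (\int[P (Some x)]_(w in G) P (X t w) (alive X u))%E.
  have mK A : measurable A -> measurable_fun G (fun w => P (X t w) A).
    move=> mA'; apply: measurable_funTS.
    exact: (measurableT_comp (measurable_kernel_event mA') (measurable_process t0)).
  have [|||||_ _] := @dominated_convergence _ Omega R (P (Some x)) G mG
    (fun n w => P (X t w) (X (later u n) @^-1` (~` [set None])))
    (fun w => P (X t w) (alive X u)) (cst 1%E) => //.
  - by move=> n; apply: mK; exact: mA.
  - by apply: mK; exact: malive.
  - apply: aeW => w Gw.
    case: (X t w) (alive_neq_None t0 (Galive _ Gw)) => // y _.
    apply: measure_cvg_eventually.
    + exact: kernel_lty.
    + by move=> n; exact: mA.
    + exact: malive.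
    + exact: alive_eventually.
  - apply/integrableP; split; first exact: measurable_cst.
    under eq_integral do rewrite abse1.
    by rewrite integral_cst// mul1e; exact: kernel_subset_lty.
  - apply: aeW => w n _ /=; rewrite gee0_abs//.
    have <- : P (X t w) setT = 1%E by exact: prob_kernel.
    by rewrite le_measure ?inE//; exact: mA.
have approx : (fun n => P (Some x) (G `&` X (later (t + u) n) @^-1` (~` [set None]))) =
    fun n => (\int[P (Some x)]_(w in G)
      P (X t w) (X (later u n) @^-1` (~` [set None])))%E.
  apply/funext => n; rewrite /later -addrA (process_markov hX)//.
  - exact: later0.
  - rewrite /measurable/= /option_measurable/= (_ : _ @^-1` _ = setT)//.
    by apply/seteqP; split.
by move: lim_left; rewrite approx => /cvg_unique; exact.
Qed.

End absorbed.

(** * Means on the survival event *)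

(** Use the partition of E into A and its complement. *)
Lemma tv_norm_ge {R : realType} {d : measure_display} {E : measurableType d}
    (nu : set E -> R) r A :
  (tv_norm nu <= r%:E)%E -> measurable A -> `|nu A| <= r.
Proof.
move=> nur mA; pose B (i : 'I_2) := if i == ord0 then A else ~` A.
have : ((\sum_(i < 2) `|nu (B i)|)%:E <= r%:E)%E.
  apply: le_trans nur; apply: ereal_sup_ubound; exists 2%N, B; split => //.
  - by move=> i; rewrite /B; case: ifP => // _; exact: measurableC.
  - move=> i j _ _ [y [yi yj]]; apply/eqP.
    by case: i j yi yj => -[|[|//]] i2 [[|[|//]] j2].
  - apply/seteqP; split => // y _.
    by have [yA|yA] := pselect (A y); [exists ord0|exists (lift ord0 ord0)].
by rewrite lee_fin big_ord_recl; apply: le_trans; rewrite lerDl sumr_ge0.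
Qed.

Section conditional_means.
Context {R : realType} {dO dE : measure_display}
  {Omega : measurableType dO} {E : measurableType dE}
  {F : R -> set (set Omega)} {X : R -> Omega -> option E}
  {P : R.-pker (option E) ~> Omega}.
Hypothesis hX : absorbed_markov_process F X P.
Implicit Types (s t u : R) (w : Omega) (x : E) (f : E -> R).

Lemma bounded_measurable_oapp f : bounded_measurable f ->
  bounded_measurable (oapp f 0 : option E -> R).
Proof.
move=> [mf [M fM]]; split.
  move=> _ B mB; rewrite setTI /measurable/= /option_measurable/=.
  by rewrite -comp_preimage -[X in measurable X]setTI; exact: mf.
exists M => -[y|]//=; rewrite normr0.
exact: le_trans (normr_ge0 _) (fM point).
Qed.

Definition survival u x : R := fine (P (Some x) (alive X u)).

(** E_x[f(X_t); s < tau]. *)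
Definition mean_alive x s t f : R :=
  \int[P (Some x)]_(w in alive X s) oapp f 0 (X t w).

Lemma survivalE u x : 0 <= u -> P (Some x) (alive X u) = (survival u x)%:E.
Proof.
move=> u0; rewrite /survival fineK// ge0_fin_numE//.
exact: kernel_subset_lty (measurable_alive hX u0).
Qed.

Lemma survival_gt0 u x : 0 <= u -> 0 < survival u x.
Proof. by move=> u0; rewrite -lte_fin -survivalE//; exact: (alive_gt0 hX). Qed.

Lemma survival_le1 u x : 0 <= u -> survival u x <= 1.
Proof.
move=> u0; rewrite -lee_fin -survivalE//.
have <- : P (Some x) setT = 1%E by exact: prob_kernel.
by rewrite le_measure ?inE//; exact: (measurable_alive hX).
Qed.

Lemma measurable_survival u : 0 <= u -> measurable_fun setT (survival u).
Proof.
move=> u0; apply: measurableT_comp => //.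
apply: (measurableT_comp (measurable_kernel_event (measurable_alive hX u0))).
exact: measurable_Some.
Qed.

Lemma bounded_measurable_survival u : 0 <= u -> bounded_measurable (survival u).
Proof.
move=> u0; split; first exact: measurable_survival.
by exists 1 => x; rewrite ger0_norm ?survival_le1// ltW// survival_gt0.
Qed.

Lemma positive_linear_process x s t : 0 <= s -> 0 <= t ->
  positive_linear (fun h : option E -> R =>
    \int[P (Some x)]_(w in alive X s) h (X t w)).
Proof.
move=> s0 t0; have ms := measurable_alive hX s0.
apply: positive_linear_mean => //; last exact: kernel_subset_lty.
exact: (measurable_process hX t0).
Qed.

Lemma mean_alive1 x s t : 0 <= t -> t <= s -> mean_alive x s t (fun=> 1) = survival s x.
Proof.
move=> t0 ts; have s0 := le_trans t0 ts.
rewrite /mean_alive /survival -[RHS]mul1r -Rintegral_cst; last exact: (measurable_alive hX).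
apply: eq_Rintegral => w; rewrite inE => sw.
by case: (X t w) (alive_neq_None t0 (alive_nonincreasing ts sw)).
Qed.

Lemma mean_alive_bound x s t f M : 0 <= t -> t <= s -> measurable_fun setT f ->
  (forall y, `|f y| <= M) -> `|mean_alive x s t f| <= M * survival s x.
Proof.
move=> t0 ts mf fM; have s0 := le_trans t0 ts.
have M0 : 0 <= M := le_trans (normr_ge0 _) (fM point).
have pI := positive_linear_process x s0 t0.
have bf : bounded_measurable (oapp f 0).
  by apply: bounded_measurable_oapp; split=> //; exists M.
have := positive_linear_dist pI bf (bounded_measurable_cst 0).
rewrite (positive_linear_cst 0 pI) mul0r => /(_ M).
rewrite subr0 Rintegral_cst ?mul1r; last exact: (measurable_alive hX).
by apply=> -[y|]/=; rewrite ?subr0 ?normr0.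
Qed.

(** Both sides are positive linear in f, so it suffices to check indicators,
    for which this is [markov_alive]. *)
Lemma markov_mean_alive x t u f : 0 <= t -> 0 <= u -> bounded_measurable f ->
  mean_alive x (t + u) t f = mean_alive x t t (fun y => f y * survival u y).
Proof.
move=> t0 u0 bf; have tu0 : 0 <= t + u by rewrite addr_ge0.
have mt := measurable_alive hX t0; have mX := measurable_process hX t0.
have ig : (P (Some x)).-integrable (alive X t) (EFin \o (fun w => oapp (survival u) 0 (X t w))).
  apply: (integrable_mean mt mX); first exact: kernel_subset_lty.
  exact/bounded_measurable_oapp/bounded_measurable_survival.
have pI := positive_linear_process x tu0 t0.
have s_ge0 w : alive X t w -> 0 <= oapp (survival u) 0 (X t w).
  by move=> _; case: (X t w) => //= y; rewrite ltW// survival_gt0.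
have pJ := positive_linear_integral mt mX ig s_ge0.
have -> : mean_alive x t t (fun y => f y * survival u y) =
    \int[P (Some x)]_(w in alive X t)
      (oapp f 0 (X t w) * oapp (survival u) 0 (X t w)).
  by apply: eq_Rintegral => w _; case: (X t w) => //=; rewrite mulr0.
apply: (positive_linear_eq pI pJ _ (bounded_measurable_oapp bf)) => B mB.
have mB' : measurable (X t @^-1` B).
  by rewrite -[X in measurable X]setTI; exact: mX.
rewrite Rintegral_indic//; last exact: (measurable_alive hX).
rewrite Rintegral_indic_comp//.
have -> : alive X (t + u) `&` X t @^-1` B =
    (alive X t `&` X t @^-1` B) `&` alive X (t + u).
  have sub : alive X (t + u) `<=` alive X t.
    by apply: alive_nonincreasing; rewrite lerDl.
  by rewrite setIAC [alive X t `&` _]setIC (setIidl sub).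
rewrite (markov_alive hX x t0 u0 (alive_preimage_adapted hX t0 mB))//.
congr fine; apply: eq_integral => w; rewrite inE => -[tw _].
by case: (X t w) (alive_neq_None t0 tw) => // y _ /=; rewrite survivalE.
Qed.

(** The total variation bound compares the two sides on measurable sets; it is
    stated unnormalised, multiplied through by S_t(x), to match the other
    estimates. *)
Lemma mean_alive_tv_gap (alpha : probability E R) x t e f M : 0 <= t ->
  (tv_norm (fun A : set E =>
     (cond_law P X (\d_x : probability E R) t A - fine (alpha A))%R) <= e%:E)%E ->
  measurable_fun setT f -> (forall y, `|f y| <= M) ->
  `|mean_alive x t t f - survival t x * \int[alpha]_y f y|
    <= 3 * M * (survival t x * e).
Proof.
move=> t0 tve mf fM; have mt := measurable_alive hX t0.
have mX := measurable_process hX t0; have st := survival_gt0 x t0.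
have bf : bounded_measurable f by split => //; exists M.
have M0 : 0 <= M := le_trans (normr_ge0 _) (fM point).
have [mof _] := bounded_measurable_oapp bf.
have pI := positive_linear_process x t0 t0.
have aoo : (alpha setT < +oo)%E by rewrite probability_setT ltry.
have pJ := positive_linearZ (ltW st)
  (positive_linear_mean measurableT measurable_Some aoo).
have fMo y : `|oapp f 0 y| <= M by case: y => [y|]//=; rewrite normr0.
apply: (positive_linear_gap pI pJ _ mof fMo) => B mB.
have PinitE G : measurable G -> Pinit P (\d_x : probability E R) G = P (Some x) G.
  move=> mG; rewrite /Pinit integral_dirac//; last first.
    exact: (measurableT_comp (measurable_kernel_event mG) measurable_Some).
  by rewrite diracT mul1e.
rewrite !Rintegral_indic//; [|exact: measurable_Some].
have mA : measurable ((Some : E -> option E) @^-1` B) by exact: mB.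
have := tv_norm_ge tve mA.
have mB' : measurable (X t @^-1` B).
  by rewrite -[X in measurable X]setTI; exact: mX.
(* A set B may contain the cemetery, but X_t avoids it while alive. *)
have GE : X t @^-1` (Some @` (Some @^-1` B)) `&` alive X t =
    alive X t `&` X t @^-1` B.
  rewrite setIC; apply/seteqP; split=> w [tw] /=.
    by move=> [y By <-].
  by case: (X t w) (alive_neq_None t0 tw) => // y _ By; split=> //; exists y.
rewrite /cond_law GE !PinitE//; last exact: measurableI.
rewrite -/(survival t x) setTI => h.
rewrite -(ler_pM2l st) in h; apply: le_trans h.
rewrite -[X in _ <= X * _]gtr0_norm// -normrM mulrBr mulrCA mulfV ?gt_eqF//.
by rewrite mulr1.
Qed.

End conditional_means.

(** * Exponential rates *)

(** Error of a ratio n / s whose numerator is close to b and whose denominator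
    is close to 1.  When the denominator may be below 1/2 nothing is gained
    from closeness, but then e > 1/2 and the trivial bound 2 M is already of
    order M e; hence there is no smallness condition on e, and small times need
    no separate treatment. *)
Lemma ratio_bound {R : realFieldType} (n s b M e k : R) :
  0 < s -> 0 <= M -> 0 <= e -> 0 <= k -> `|b| <= M -> `|n| <= M * s ->
  `|s - 1| <= e -> `|n - b| <= M * e + M * k ->
  `|n / s - b| <= 4 * M * (e + k).
Proof.
move=> s0 M0 e0 k0 bM nM se nb.
have Me := mulr_ge0 M0 e0; have Mk := mulr_ge0 M0 k0.
have [e2|e2] := leP e 2^-1.
  have s2 : 2^-1 <= s by move: se; rewrite ler_norml => /andP[]; lra.
  rewrite (_ : n / s - b = (n - b - b * (s - 1)) / s); last first.
    by field; rewrite gt_eqF.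
  rewrite normrM normfV (gtr0_norm s0) ler_pdivrMr//.
  have h : `|n - b - b * (s - 1)| <= M * e + M * k + M * e.
    by rewrite (le_trans (ler_normB _ _))// lerD// normrM ler_pM.
  have A0 : 0 <= 4 * M * (e + k) by rewrite !mulr_ge0// addr_ge0.
  apply: (le_trans h); apply: le_trans (ler_wpM2l A0 s2); lra.
have h : `|n / s - b| <= M + M.
  rewrite (le_trans (ler_normB _ _))// lerD// normrM normfV (gtr0_norm s0).
  by rewrite ler_pdivrMr.
have : M * 2^-1 <= M * e by rewrite ler_wpM2l// ltW.
by move: h; set z := `|_|; lra.
Qed.

Section probability_integrals.
Context {R : realType} {d : measure_display} {E : measurableType d}.
Variable m : probability E R.

Lemma probability_lty : (m setT < +oo)%E.
Proof. by rewrite probability_setT ltry. Qed.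

Lemma bounded_measurable_integrable h : bounded_measurable h ->
  m.-integrable setT (EFin \o h).
Proof.
move=> bh.
have mid : measurable_fun setT (@id E) by exact: measurable_id.
exact: (integrable_mean measurableT mid probability_lty bh).
Qed.

Lemma le_norm_mean h k : bounded_measurable h -> (forall y, `|h y| <= k) ->
  `|\int[m]_y h y| <= k.
Proof.
move=> bh hk; have ih := bounded_measurable_integrable bh.
apply: (le_trans (le_normr_Rintegral measurableT ih)).
rewrite -[leRHS]mulr1 -[X in _ <= _ * X]/(fine 1%E) -(probability_setT m).
rewrite -Rintegral_cst//; apply: le_Rintegral => //.
- exact: integrable_norm.
- exact: bounded_measurable_integrable (bounded_measurable_cst k).
Qed.

End probability_integrals.

Definition mixing_error {R : realType} (C gamma t : R) : R :=
  C * expR (- (gamma * t)).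

Section uniform_convergence.
Context {R : realType} {dO dE : measure_display}
  {Omega : measurableType dO} {E : measurableType dE}
  {F : R -> set (set Omega)} {X : R -> Omega -> option E}
  {P : R.-pker (option E) ~> Omega}
  {alpha : probability E R} {C gamma : R}
  {lambda0 : R} {eta : E -> R} {beta : probability E R}.
Hypotheses (hX : absorbed_markov_process F X P) (hC : 0 < C)
  (hconv : forall (mu : probability E R) (t : R), 0 <= t ->
     (tv_norm (fun A : set E => (cond_law P X mu t A - fine (alpha A))%R)
        <= (C * expR (- (gamma * t)))%:E)%E)
  (heta : survival_rate_and_profile P X alpha lambda0 eta)
  (hbeta : forall A : set E, measurable A ->
     beta A = (\int[alpha]_(x in A) (eta x)%:E)%E).
Implicit Types (t u e : R) (x : E) (f : E -> R).

Local Notation err := (mixing_error C gamma).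

Let err_ge0 t : 0 <= err t.
Proof. by rewrite mulr_ge0 ?expR_ge0// ltW. Qed.

Local Notation survival := (@survival R dO dE Omega E X P).
Local Notation mean_alive := (@mean_alive R dO dE Omega E X P).

(** The function whose uniform limit as t tends to infinity is eta. *)
Definition rescaled_survival t x := expR (lambda0 * t) * survival t x.
Local Notation rescaled := rescaled_survival.

Lemma mean_alive_gap x t f M : 0 <= t -> measurable_fun setT f ->
  (forall y, `|f y| <= M) ->
  `|mean_alive x t t f - survival t x * \int[alpha]_y f y|
    <= 3 * M * (survival t x * err t).
Proof. by move=> t0 mf fM; apply: (mean_alive_tv_gap hX t0 _ mf fM); exact: hconv. Qed.

Lemma alpha_survival u : 0 <= u ->
  \int[alpha]_y survival u y = expR (- (lambda0 * u)).
Proof.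
move=> u0; rewrite /Rintegral -[RHS]/(fine (expR (- (lambda0 * u)))%:E).
rewrite -(rate_survival heta u0); congr fine.
by apply: eq_integral => y _; rewrite (survivalE hX).
Qed.

Lemma rescaled_survival_cvg e : 0 < e ->
  exists2 t1, 0 <= t1 & forall t x, t1 <= t -> `|rescaled t x - eta x| <= e.
Proof.
move=> e0; have /fine_cvgP[finl] := profile_limit heta.
move=> /cvgr0Pnorm_le/(_ e e0) liml.
have [t1 [t1r near1]] := filterI finl liml.
exists (Num.max 0 (t1 + 1)) => [|t x]; first by rewrite le_max lexx.
rewrite ge_max => /andP[t0 t1t].
have [|fin1 le1] := near1 t; first by rewrite (lt_le_trans _ t1t)// ltrDl.
have xsup : (`|rescaled t x - eta x|%:E <= ereal_sup (range (fun x : E =>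
  `| (expR (lambda0 * t))%:E * P (Some x) (alive X t) - (eta x)%:E |)))%E.
  by apply: ereal_sup_ubound; exists x => //; rewrite (survivalE hX).
move: xsup le1; rewrite -(fineK fin1) lee_fin => /le_trans + le1; apply.
exact: le_trans (ler_norm _) le1.
Qed.

(** Past some time t1 the rescaled survival is within 1 of eta, and before t1
    it is at most exp(lambda0 t1); at t1 both hold, which bounds eta. *)
Lemma rescaled_survival_bounded : exists2 K, 0 < K &
  forall x, eta x <= K /\ forall t, 0 <= t -> rescaled t x <= K.
Proof.
have [t1 t10 h1] := rescaled_survival_cvg ltr01.
have le_exp t x : 0 <= t -> t <= t1 -> rescaled t x <= expR (lambda0 * t1).
  move=> t0 tt1; rewrite -[leRHS]mulr1 ler_pM ?expR_ge0//.
  - by rewrite ltW// (survival_gt0 hX).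
  - by rewrite ler_expR ler_wpM2l// ltW// (rate_gt0 heta).
  - exact: (survival_le1 hX).
have eta_le x : eta x <= 1 + expR (lambda0 * t1).
  have := h1 t1 x (lexx _); have := le_exp t1 x t10 (lexx _).
  by rewrite ler_norml => ? /andP[]; lra.
exists (2 + expR (lambda0 * t1)) => [|x]; first by rewrite addr_gt0 ?expR_gt0.
split=> [|t t0]; first by have := eta_le x; lra.
have [tt1|/ltW t1t] := leP t t1; first by have := le_exp t x t0 tt1; lra.
by have := h1 t x t1t; have := eta_le x; rewrite ler_norml => ? /andP[]; lra.
Qed.

(** A pointwise limit of measurable functions. *)
Lemma measurable_eta : measurable_fun setT eta.
Proof.
apply: (@measurable_fun_cvg _ _ _ setT
  (fun n x => rescaled n%:R x) _).
  move=> n; apply: measurable_funM => //; exact: (measurable_survival hX).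
move=> x _; apply/cvgrPdist_le => e e0.
have [t1 t10 h1] := rescaled_survival_cvg e0.
near=> n; rewrite distrC; apply: h1.
near: n; exact: nbhs_infty_ger.
Unshelve. all: by end_near. Qed.

Section with_bound.
Variable K : R.
Hypotheses (K0 : 0 < K) (etaK : forall x, eta x <= K)
  (rescaledK : forall t x, 0 <= t -> rescaled t x <= K).

Let survivalK u x : 0 <= u -> survival u x <= K * expR (- (lambda0 * u)).
Proof.
move=> u0; rewrite -ler_pdivrMr ?expR_gt0// expRN invrK mulrC.
exact: rescaledK.
Qed.

Let survival_norm u x : 0 <= u -> `|survival u x| <= K * expR (- (lambda0 * u)).
Proof. by move=> u0; rewrite gtr0_norm ?(survival_gt0 hX)// survivalK. Qed.

Let bounded_measurable_eta : bounded_measurable eta.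
Proof.
split; first exact: measurable_eta.
by exists K => x; rewrite gtr0_norm// (profile_gt0 heta).
Qed.

(** Survival to time t + u is survival to t followed by survival for u from the
    current position, whose law is nearly alpha; from alpha the latter has
    probability exactly exp(- lambda0 u). *)
Lemma survival_add_gap x t u : 0 <= t -> 0 <= u ->
  `|survival (t + u) x - survival t x * expR (- (lambda0 * u))|
    <= 3 * (K * expR (- (lambda0 * u))) * (survival t x * err t).
Proof.
move=> t0 u0; rewrite -(mean_alive1 hX x t0) ?lerDl//.
rewrite (markov_mean_alive hX x t0 u0); last exact: bounded_measurable_cst.
under eq_fun do rewrite mul1r.
rewrite -[X in `|_ - _ * X|]alpha_survival//.
apply: mean_alive_gap => //; first exact: (measurable_survival hX).
by move=> y; exact: survival_norm.
Qed.

(** The increments from t to t + u are bounded uniformly in u, so the bound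
    passes to the limit in u. *)
Lemma rescaled_survival_rate x t : 0 <= t ->
  `|rescaled t x - eta x| <= 3 * K ^+ 2 * err t.
Proof.
move=> t0; apply/ler_addgt0Pr => e e0.
have [u u0 hu] := rescaled_survival_cvg e0.
have h1 : `|rescaled (t + u) x - eta x| <= e.
  by apply: hu; rewrite lerDr.
have h2 : `|rescaled (t + u) x - rescaled t x| <= 3 * K ^+ 2 * err t.
  have := survival_add_gap x t0 u0.
  have Et : 0 < expR (lambda0 * t) by exact: expR_gt0.
  have Eu : 0 < expR (lambda0 * u) by exact: expR_gt0.
  rewrite -(ler_pM2l (mulr_gt0 Et Eu)) -[X in X * `|_|]gtr0_norm ?mulr_gt0//.
  rewrite -normrM expRN => h.
  rewrite (_ : rescaled (t + u) x - rescaled t x =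
    expR (lambda0 * t) * expR (lambda0 * u) *
     (survival (t + u) x - survival t x / expR (lambda0 * u))); last first.
    by rewrite /rescaled mulrDr expRD; field; rewrite gt_eqF.
  apply: (le_trans h); rewrite [leLHS](_ : _ = 3 * K * err t * rescaled t x).
    rewrite expr2 (_ : 3 * (K * K) * err t = 3 * K * err t * K); last by ring.
    by rewrite ler_wpM2l ?rescaledK// !mulr_ge0// ltW.
  by rewrite /rescaled; field; rewrite gt_eqF.
rewrite (_ : rescaled t x - eta x = (rescaled (t + u) x - eta x) -
  (rescaled (t + u) x - rescaled t x)); last by ring.
by rewrite (le_trans (ler_normB _ _))// addrC lerD.
Qed.

(** Both sides agree on indicators by definition of beta. *)
Lemma beta_density f : bounded_measurable f ->
  \int[beta]_y f y = \int[alpha]_y (f y * eta y).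
Proof.
move=> bf.
have mid : measurable_fun setT (@id E) by exact: measurable_id.
have boo (m : probability E R) : (m setT < +oo)%E by rewrite probability_setT ltry.
have ie := integrable_mean measurableT mid (boo alpha) bounded_measurable_eta.
have pI := positive_linear_mean measurableT mid (boo beta).
have e0 w : [set: E] w -> 0 <= (eta \o id) w by move=> _; rewrite ltW// (profile_gt0 heta).
have pJ := positive_linear_integral measurableT mid ie e0.
apply: (positive_linear_eq pI pJ _ bf) => B mB.
by rewrite Rintegral_indic// Rintegral_indic_comp// !setTI /= hbeta.
Qed.

(** The estimate at a time t with u left before the conditioning horizon.
    Numerator and denominator are first divided by S_t(x) exp(- lambda0 u), the
    leading order of S_{t+u}(x) for large t, which makes the close to 1 and the numerator close to the integral of f eta. *)
Lemma conditional_mean_rate x t u f M : 0 <= t -> 0 <= u ->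
  measurable_fun setT f -> (forall y, `|f y| <= M) ->
  `|mean_alive x (t + u) t f / survival (t + u) x - \int[beta]_y f y|
    <= 4 * M * (3 * K * err t + 3 * K ^+ 2 * err u).
Proof.
move=> t0 u0 mf fM; have tu0 : 0 <= t + u by rewrite addr_ge0.
have M0 : 0 <= M := le_trans (normr_ge0 _) (fM point).
have bf : bounded_measurable f by split=> //; exists M.
pose q := survival t x * expR (- (lambda0 * u)).
have q0 : 0 < q by rewrite mulr_gt0 ?expR_gt0// (survival_gt0 hX).
have s0 : 0 < survival (t + u) x by exact: (survival_gt0 hX).
have bs := bounded_measurable_survival hX u0.
have bfs := bounded_measurableM bf bs.
have gap_num : `|mean_alive x (t + u) t f - survival t x * \int[alpha]_y (f y * survival u y)|
    <= q * (M * (3 * K * err t)).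
  rewrite (markov_mean_alive hX x t0 u0)//.
  rewrite (_ : q * _ = 3 * (M * (K * expR (- (lambda0 * u)))) * (survival t x * err t)).
    apply: mean_alive_gap => //; first by case: bfs.
    by move=> y; rewrite normrM ler_pM// survival_norm.
  by rewrite /q; ring.
have gap_alpha : `|\int[alpha]_y (f y * survival u y) -
     expR (- (lambda0 * u)) * \int[alpha]_y (f y * eta y)|
    <= expR (- (lambda0 * u)) * (M * (3 * K ^+ 2 * err u)).
  have bfe := bounded_measurableM bf bounded_measurable_eta.
  have bce := bounded_measurableM (bounded_measurable_cst (expR (- (lambda0 * u)))) bfe.
  rewrite -RintegralZl//; last exact: bounded_measurable_integrable.
  rewrite -RintegralB//; [|exact: bounded_measurable_integrable..].
  apply: le_norm_mean.
    have := bounded_measurable_lin (-1) bce bfs.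
    by under [X in bounded_measurable X -> _]eq_fun do rewrite mulN1r addrC.
  move=> y; rewrite (_ : f y * survival u y - _ =
    expR (- (lambda0 * u)) * (f y * (rescaled u y - eta y))); last first.
    by rewrite /rescaled expRN; field; rewrite gt_eqF// expR_gt0.
  rewrite normrM gtr0_norm ?expR_gt0// ler_wpM2l ?expR_ge0//.
  by rewrite normrM ler_pM// rescaled_survival_rate.
pose n := mean_alive x (t + u) t f / q; pose s := survival (t + u) x / q.
have -> : mean_alive x (t + u) t f / survival (t + u) x = n / s.
  by rewrite /n /s; field; rewrite !gt_eqF.
apply: ratio_bound => //.
- by rewrite divr_gt0.
- by rewrite !mulr_ge0// ltW.
- by rewrite !mulr_ge0// ltW.
- exact: le_norm_mean.
- rewrite /n /s mulrA normrM normfV (gtr0_norm q0) ler_wpM2r ?invr_ge0 ?(ltW q0)//.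
  by apply: (mean_alive_bound hX) => //; rewrite lerDl.
- have := survival_add_gap x t0 u0; rewrite -/q.
  rewrite (_ : survival (t + u) x - q = q * (s - 1)); last first.
    by rewrite /s; field; rewrite gt_eqF.
  rewrite normrM (gtr0_norm q0) => h; rewrite -(ler_pM2l q0).
  by apply: (le_trans h); rewrite /q le_eqVlt; apply/orP; left; apply/eqP; ring.
rewrite (beta_density bf) -(ler_pM2l q0) -[X in X * `|_|]gtr0_norm// -normrM.
set Be := \int[alpha]_y (f y * eta y).
set Bs := \int[alpha]_y (f y * survival u y) in gap_num gap_alpha.
rewrite (_ : q * (n - Be) = (mean_alive x (t + u) t f - survival t x * Bs) +
  survival t x * (Bs - expR (- (lambda0 * u)) * Be)); last first.
  by rewrite /n mulrBr mulrCA mulfV ?gt_eqF// /q; ring.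
apply: (le_trans (ler_normD _ _)); rewrite [leRHS]mulrDr; apply: lerD => //.
by rewrite normrM gtr0_norm ?(survival_gt0 hX)// /q -[leRHS]mulrA ler_wpM2l// ltW// (survival_gt0 hX).
Qed.

End with_bound.

End uniform_convergence.

(** * Time averages *)

Section bounded_Fubini.
Context {d1 d2 : measure_display} {T1 : measurableType d1}
  {T2 : measurableType d2} {R : realType}.
Variables (m1 : {sigma_finite_measure set T1 -> \bar R})
  (m2 : {sigma_finite_measure set T2 -> \bar R})
  (D1 : set T1) (D2 : set T2) (k : T1 -> T2 -> R) (M : R).
Hypotheses (mD1 : measurable D1) (mD2 : measurable D2)
  (D1oo : (m1 D1 < +oo)%E) (D2oo : (m2 D2 < +oo)%E)
  (mk : measurable_fun (D1 `*` D2) (fun z => k z.1 z.2))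
  (kM : forall x y, `|k x y| <= M).

(* Extension by zero: the integrand is measurable on the rectangle only. *)
Let h : T1 * T2 -> \bar R :=
  (EFin \o (fun z => k z.1 z.2)) \_ (D1 `*` D2).

Let mD : measurable (D1 `*` D2).
Proof. exact: measurableX. Qed.

Let mh : measurable_fun setT h.
Proof. by apply/(measurable_restrictT _ _).1 => //; exact/measurable_EFinP. Qed.

Let bounded_k (A : Type) (D : set A) (g : A -> T1 * T2) :
  [bounded k (g z).1 (g z).2 | z in D].
Proof.
exists M; split; first exact: num_real.
by move=> x Mx z _; rewrite /= (le_trans (kM _ _))// ltW.
Qed.

Let ih : (m1 \x m2)%E.-integrable setT h.
Proof.
apply/integrable_restrict => //; rewrite setTI.
apply: measurable_bounded_integrable => //.
by rewrite [X in (X < _)%E](product_measure1E m1 m2 mD1 mD2) lte_mul_pinfty// ge0_fin_numE.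
Qed.

Let section1 x : D1 x -> (fun y => h (x, y)) = (EFin \o k x) \_ D2.
Proof.
move=> Dx; apply/funext => y; rewrite /h !patchE.
by rewrite (_ : ((x, y) \in D1 `*` D2) = (y \in D2))//; apply/idP/idP; rewrite !inE => // -[].
Qed.

Let section2 y : D2 y -> (fun x => h (x, y)) = (EFin \o k^~ y) \_ D1.
Proof.
move=> Dy; apply/funext => x; rewrite /h !patchE.
by rewrite (_ : ((x, y) \in D1 `*` D2) = (x \in D1))//; apply/idP/idP; rewrite !inE => // -[].
Qed.

Let integrable1 x : D1 x -> m2.-integrable D2 (EFin \o k x).
Proof.
move=> Dx; apply: measurable_bounded_integrable => //.
  apply/measurable_EFinP/(measurable_restrictT _ _).2 => //.
  by rewrite -section1//; exact: (measurableT_comp mh (pair1_measurable x)).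
exact: (bounded_k D2 (fun y => (x, y))).
Qed.

Let integrable2 y : D2 y -> m1.-integrable D1 (EFin \o k^~ y).
Proof.
move=> Dy; apply: measurable_bounded_integrable => //.
  apply/measurable_EFinP/(measurable_restrictT _ _).2 => //.
  by rewrite -section2//; exact: (measurableT_comp mh (pair2_measurable y)).
exact: (bounded_k D1 (fun x => (x, y))).
Qed.

Let fubini_FE : fubini_F m2 h =
  (EFin \o (fun x => \int[m2]_(y in D2) k x y)) \_ D1.
Proof.
apply/funext => x; rewrite patchE; case: ifPn => [/set_mem Dx|/negP Dx].
  rewrite /fubini_F (section1 Dx) -integral_mkcond /= /Rintegral fineK//.
  exact: integrable_fin_num (integrable1 Dx).
rewrite /fubini_F; apply: integral0_eq => y _; rewrite /h patchE ifF//.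
by apply/negP => /set_mem[/mem_set].
Qed.

Let fubini_GE : fubini_G m1 h =
  (EFin \o (fun y => \int[m1]_(x in D1) k x y)) \_ D2.
Proof.
apply/funext => y; rewrite patchE; case: ifPn => [/set_mem Dy|/negP Dy].
  rewrite /fubini_G (section2 Dy) -integral_mkcond /= /Rintegral fineK//.
  exact: integrable_fin_num (integrable2 Dy).
rewrite /fubini_G; apply: integral0_eq => x _; rewrite /h patchE ifF//.
by apply/negP => /set_mem[_ /mem_set].
Qed.

Lemma integrable_bounded_fubini :
  m1.-integrable D1 (EFin \o (fun x => \int[m2]_(y in D2) k x y)).
Proof.
rewrite -[D1]setTI; apply/integrable_restrict => //.
by rewrite -fubini_FE; exact: integrable_fubini_F.
Qed.

Lemma bounded_Fubini : \int[m2]_(y in D2) (\int[m1]_(x in D1) k x y) =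
  \int[m1]_(x in D1) (\int[m2]_(y in D2) k x y).
Proof.
rewrite /Rintegral; congr fine; rewrite integral_mkcond [RHS]integral_mkcond.
rewrite -[X in (\int[m2]_x X x = _)%E]/(_ \_ D2) -fubini_GE -fubini_FE.
exact/esym/(Fubini ih).
Qed.

End bounded_Fubini.

Lemma is_derive_expR_affine {R : realType} (a b t : R) :
  is_derive t (1:R) (fun t => expR (a * t + b)) (expR (a * t + b) * a).
Proof.
have lin : is_derive t (1:R) (fun t : R => a * t + b) a.
  by apply: is_derive_eq; rewrite addr0 -[RHS]mulr1.
exact: (@is_derive1_comp R expR (fun t => a * t + b)).
Qed.

Lemma continuous_expR_affine {R : realType} (a b : R) :
  continuous (fun t : R => expR (a * t + b)).
Proof.
move=> t; apply: differentiable_continuous; apply/derivable1_diffP.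
by have [] := is_derive_expR_affine a b t.
Qed.

(** Errors concentrated near the two ends of [0, T] have a total that does not
    grow with T. *)
Lemma integral_exp_ends {R : realType} (c T : R) : 0 < c -> 0 < T ->
  \int[lebesgue_measure]_(t in `[0%R, T])
    (expR (- (c * t)) + expR (- (c * (T - t)))) <= 2 / c.
Proof.
move=> c0 T0.
pose G t := c^-1 * (expR (c * t + - (c * T)) - expR (- c * t + 0)).
pose g t := expR (- c * t + 0) + expR (c * t + - (c * T)).
have dG t : is_derive t (1:R) G (g t).
  have d1 := is_derive_expR_affine c (- (c * T)) t.
  have d2 := is_derive_expR_affine (- c) 0 t.
  have dB := is_deriveB d1 d2.
  have := is_deriveZ c^-1 dB.
  move=> /is_derive_eq; apply.
  by rewrite /g /GRing.scale/=; field; rewrite gt_eqF.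
have cg : continuous g.
  by move=> t; apply: cvgD; exact: continuous_expR_affine.
have cG : continuous G.
  move=> t; apply: differentiable_continuous; apply/derivable1_diffP.
  by have [] := dG t.
rewrite [leLHS](_ : _ = \int[lebesgue_measure]_(t in `[0%R, T]) g t); last first.
  apply: eq_Rintegral => t _; rewrite /g addr0 mulNr; congr (_ + expR _); ring.
rewrite /Rintegral (@continuous_FTC2 _ g G)//.
- rewrite /= /G mulr0 add0r mulNr addr0 subrr expR0 mulr0 addr0.
  have := expR_gt0 (- (c * T)); set z := expR _ => z0.
  rewrite expR0 -mulrBr mulrC ler_wpM2r ?invr_ge0 ?ltW//.
  lra.
- exact: continuous_subspaceT.
- split.
  + by move=> t _; have [] := dG t.
  + by apply/cvg_at_right_filter; exact: cG.
  + by apply/cvg_at_left_filter; exact: cG.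
- by move=> t _; rewrite derive1E; have [_ ->] := dG t.
Qed.

Section time_average.
Context {R : realType} {dO dE : measure_display}
  {Omega : measurableType dO} {E : measurableType dE}
  {F : R -> set (set Omega)} {X : R -> Omega -> option E}
  {P : R.-pker (option E) ~> Omega}.
Hypothesis hX : absorbed_markov_process F X P.
Implicit Types (x : E) (f : E -> R) (T : R).

(** P_x as a probability measure, so that it inherits the sigma-finiteness
    that Fubini requires. *)
Definition law_from x : set Omega -> \bar R := P (Some x).
HB.instance Definition _ x := Measure.on (law_from x).
HB.instance Definition _ x :=
  Measure_isProbability.Build _ _ _ (law_from x) (prob_kernel (Some x)).

Local Notation mean_alive := (@mean_alive R dO dE Omega E X P).
Local Notation survival := (@survival R dO dE Omega E X P).

Lemma lebesgue_measure_segment T : 0 < T ->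
  lebesgue_measure `[0%R, T] = T%:E.
Proof. by move=> T0; rewrite lebesgue_measure_itv/= lte_fin T0 sube0. Qed.

Let segment_lty T : 0 < T -> (lebesgue_measure `[0%R, T] < +oo)%E.
Proof. by move=> T0; rewrite lebesgue_measure_segment ?ltry. Qed.

Let segment_alive_sub T :
  `[0%R, T] `*` alive X T `<=` [set z : R * Omega | 0 <= z.1].
Proof. by move=> z [/=]; rewrite in_itv/= => /andP[]. Qed.

Lemma measurable_times_ge0 : measurable [set z : R * Omega | 0 <= z.1].
Proof.
rewrite [X in measurable X](_ : _ = `[0%R, +oo[ `*` setT).
  exact: measurableX.
by apply/seteqP; split => z /=; rewrite in_itv/= andbT// => -[].
Qed.

Lemma measurable_process_segment f T : 0 < T -> bounded_measurable f ->
  measurable_fun (`[0%R, T] `*` alive X T) (fun z => oapp f 0 (X z.1 z.2)).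
Proof.
move=> T0 bf; have [mof _] := bounded_measurable_oapp bf.
apply: (measurable_funS measurable_times_ge0 (@segment_alive_sub T)).
exact: (measurableT_comp mof (process_jointly_measurable hX)).
Qed.

Lemma measurable_process_segment_swap f T : 0 < T -> bounded_measurable f ->
  measurable_fun (alive X T `*` `[0%R, T]) (fun z => oapp f 0 (X z.2 z.1)).
Proof.
move=> T0 bf; have mA := measurable_alive hX (ltW T0).
have := measurable_comp _ _ (measurable_process_segment T0 bf)
  (measurable_funTS (@measurable_swap _ _ Omega R)).
apply; first exact: measurableX.
by move=> z [y [y1 y2] <-].
Qed.

(** Exchange the time integral with the expectation on T < tau.  The
    integrability of the mean in t comes with it, since the product integrand
    is bounded on a set of finite measure. *)
Lemma cond_expectation_time_average x f T : 0 < T -> bounded_measurable f ->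
  lebesgue_measure.-integrable `[0%R, T] (EFin \o (fun t => mean_alive x T t f)) /\
  cond_expectation (P (Some x)) (alive X T) (time_average X f T) =
    T^-1 * (\int[lebesgue_measure]_(t in `[0%R, T]) mean_alive x T t f) / survival T x.
Proof.
move=> T0 bf; have [mf [M fM]] := bf; have mA := measurable_alive hX (ltW T0).
have mI : measurable (`[0%R, T] : set R) by exact: measurable_itv.
have Aoo := kernel_subset_lty (P := P) (Some x) mA.
have kM (t : R) w : `|oapp f 0 (X t w)| <= M.
  case: (X t w) => [y|]//=; rewrite normr0.
  exact: le_trans (normr_ge0 _) (fM point).
have mk := measurable_process_segment T0 bf.
have mk' := measurable_process_segment_swap T0 bf.
split.
  exact: (integrable_bounded_fubini (T1 := measurableTypeR R)
    (m1 := lebesgue_measure) (m2 := law_from x)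
    mI mA (segment_lty T0) Aoo mk kM).
have itime : (P (Some x)).-integrable (alive X T)
    (EFin \o fun w => \int[lebesgue_measure]_(t in `[0%R, T]) oapp f 0 (X t w)).
  exact: (integrable_bounded_fubini (T2 := measurableTypeR R)
    (m1 := law_from x) (m2 := lebesgue_measure)
    mA mI Aoo (segment_lty T0) mk' (fun w t => kM t w)).
rewrite /cond_expectation /time_average -/(survival T x); congr (_ / _).
rewrite RintegralZl//; congr (_ * _).
exact: (bounded_Fubini (T1 := measurableTypeR R)
  (m1 := lebesgue_measure) (m2 := law_from x)
  mI mA (segment_lty T0) Aoo mk kM).
Qed.

End time_average.

Lemma sup_norm_ge {R : realType} {d : measure_display} {E : measurableType d}
    (f : E -> R) y :
  bounded_fun f -> `|f y| <= sup_norm f.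
Proof.
move=> [M [_ fM]]; apply: sup_upper_bound; last by exists y.
split; first by exists `|f y|; exists y.
exists (M + 1) => _ [z _ <-].
by apply: fM => //; rewrite ltrDl.
Qed.

Theorem corollary2p3 (R : realType) (dO dE : measure_display)
  (Omega : measurableType dO) (E : measurableType dE)
  (F : R -> set (set Omega)) (X : R -> Omega -> option E)
  (P : R.-pker (option E) ~> Omega)
  (hX : absorbed_markov_process F X P)
  (alpha : probability E R) (C gamma : R) (hC : 0 < C) (hgamma : 0 < gamma)
  (hconv : forall (mu : probability E R) (t : R), 0 <= t ->
     (tv_norm (fun A : set E => (cond_law P X mu t A - fine (alpha A))%R)
        <= (C * expR (- (gamma * t)))%:E)%E)
  (lambda0 : R) (eta : E -> R)
  (heta : survival_rate_and_profile P X alpha lambda0 eta)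
  (beta : probability E R)
  (hbeta : forall A : set E, measurable A ->
     beta A = (\int[alpha]_(x in A) (eta x)%:E)%E) :
  exists a4 : R, 0 < a4 /\
    forall (x : E) (T : R), 0 < T ->
    forall f : E -> R, measurable_fun setT f -> bounded_fun f ->
      `| cond_expectation (P (Some x)) (alive X T) (time_average X f T)
         - (\int[beta]_y f y)%R | <= a4 * sup_norm f / T.
Proof.
have [K K0 HK] := rescaled_survival_bounded hX heta.
pose a : R := 4 * (3 * K + 3 * K ^+ 2) * C.
have a0 : 0 < a.
  have K2 : 0 < K ^+ 2 by rewrite exprn_gt0.
  by rewrite /a !mulr_gt0// addr_gt0// mulr_gt0.
exists (a * (2 / gamma)); split; first by rewrite mulr_gt0// divr_gt0.
move=> x T T0 f mf bdf.
have fM y := sup_norm_ge y bdf; set M := sup_norm f in fM *.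
have M0 : 0 <= M := le_trans (normr_ge0 _) (fM point).
have bf : bounded_measurable f by split=> //; exists M.
have sT0 := survival_gt0 hX x (ltW T0).
have [imean ->] := cond_expectation_time_average hX x T0 bf.
set b := \int[beta]_y f y.
pose ends t := expR (- (gamma * t)) + expR (- (gamma * (T - t))).
have mI : measurable (`[0%R, T] : set (measurableTypeR R)) by exact: measurable_itv.
have Ioo : (lebesgue_measure `[0%R, T] < +oo :> \bar R)%E.
  by rewrite lebesgue_measure_segment ?ltry.
have rate t : t \in `[0%R, T] ->
    `|@mean_alive _ _ _ _ _ X P x T t f / @survival _ _ _ _ _ X P T x - b| <= a * M * ends t.
  rewrite in_itv/= => /andP[t0 tT].
  have u0 : 0 <= T - t by rewrite subr_ge0.
  have := conditional_mean_rate hX hC hconv heta hbeta K0 (fun y => (HK y).1)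
    (fun s y => (HK y).2 s) x t0 u0 mf fM.
  rewrite (addrC t) subrK => /le_trans; apply.
  rewrite /mixing_error /a /ends; set e1 := expR _; set e2 := expR _.
  have e10 : 0 <= e1 := expR_ge0 _.
  have e20 : 0 <= e2 := expR_ge0 _.
  have c1 : 0 <= C * M * K * e1 by rewrite !mulr_ge0// ltW.
  have c2 : 0 <= C * M * K * e2 by rewrite !mulr_ge0// ltW.
  have c3 : 0 <= C * M * K ^+ 2 * e1 by rewrite !mulr_ge0// ?exprn_ge0// ltW.
  (* The bound carries K against e1 and K^2 against e2; both are enlarged
     to K + K^2. *)
  nra.
set mT := fun t => @mean_alive _ _ _ _ _ X P x T t f in imean rate *.
set S := @survival _ _ _ _ _ X P T x in sT0 rate *.
have iS : lebesgue_measure.-integrable `[0%R, T] (EFin \o (fun t => mT t / S)).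
  by have := integrableZr mI S^-1 imean.
have ib : lebesgue_measure.-integrable `[0%R, T] (EFin \o (fun=> b)).
  apply: measurable_bounded_integrable => //; exact: bounded_cst.
have iends : lebesgue_measure.-integrable `[0%R, T] (EFin \o ends).
  apply: continuous_compact_integrable; first exact: segment_compact.
  have -> : ends = fun t =>
      expR (- gamma * t + 0) + expR (gamma * t + - (gamma * T)).
    by apply/funext => t; rewrite /ends addr0 mulNr; congr (_ + expR _); ring.
  by apply: continuous_subspaceT => t; apply: cvgD; exact: continuous_expR_affine.
have -> : T^-1 * (\int[lebesgue_measure]_(t in `[0%R, T]) mT t) / S - b =
    T^-1 * \int[lebesgue_measure]_(t in `[0%R, T]) (mT t / S - b).
  rewrite RintegralB// RintegralZr// Rintegral_cst// [X in fine X](lebesgue_measure_segment T0)/=.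
  by field; rewrite !gt_eqF.
rewrite normrM gtr0_norm ?invr_gt0// mulrC ler_wpM2r ?invr_ge0 ?(ltW T0)//.
apply: (le_trans (le_normr_Rintegral mI _)).
  by have := integrableB mI iS ib.
apply: (@le_trans _ _ (\int[lebesgue_measure]_(t in `[0%R, T]) (a * M * ends t))).
  apply: le_Rintegral => //.
  - by apply: integrable_norm; have := integrableB mI iS ib.
  - by have := integrableZl mI (a * M) iends.
rewrite RintegralZl// (_ : a * (2 / gamma) * M = a * M * (2 / gamma)); last by ring.
by rewrite ler_wpM2l ?integral_exp_ends// mulr_ge0// ltW.
Qed.
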